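(* Let $S$ be a set of nonzero vectors of $\mathbb Z_2^4$ with $|S|\ge 14$. Then the inclusion $X[S]\hookrightarrow X(\mathbb Z_2^4)$ does not admit a lift to a nondegenerate simplicial map $X[S]\to X(\mathbb Z^4)$.
   Context: $\mathbb Z_2=\mathbb Z/2\mathbb Z$. $X(\mathbb Z_2^4)$ is the simplicial complex whose vertices are the $15$ nonzero vectors of $\mathbb Z_2^4$ and whose simplices are the linearly independent subsets of $\mathbb Z_2^4$. For a set $S$ of its vertices, $X[S]=\{\sigma\in X(\mathbb Z_2^4)\mid\sigma\subset S\}$ is the induced subcomplex on $S$. $X(\mathbb Z^4)$ is the simplicial complex whose vertices are the primitive vectors of $\mathbb Z^4$ and whose simplices are the unimodular subsets, i.e. the subsets that are part of a $\mathbb Z$-basis of $\mathbb Z^4$. Reduction mod $2$ gives a simplicial map $X(\mathbb Z^4)\to X(\mathbb Z_2^4)$. A simplicial map is nondegenerate if it is injective on each simplex. A lift of the inclusion $X[S]\hookrightarrow X(\mathbb Z_2^4)$ is a nondegenerate simplicial map $X[S]\to X(\mathbb Z^4)$ whose composition with reduction mod $2$ is the inclusion. *)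

(* Defs.v *)
From HB Require Import structures.
From mathcomp Require Import all_boot all_order all_algebra finmap.
Set Implicit Arguments.
Unset Strict Implicit.
Unset Printing Implicit Defensive.
Import Order.TTheory GRing.Theory Num.Theory.
Local Open Scope ring_scope.
Local Open Scope fset_scope.

(* The empty set may be a simplex. *)
Record simplicial_complex (V : choiceType) := SimplicialComplex {
  vertex : pred V;
  simplex : {fset V} -> Prop;
  simplex_vertex : forall (s : {fset V}) v, simplex s -> v \in s -> vertex v;
  simplex1 : forall v, vertex v -> simplex [fset v];
  simplexS : forall s t : {fset V}, s `<=` t -> simplex t -> simplex s }.

Section Induced.
Variables (V : choiceType) (K : simplicial_complex V) (S : {fset V}).

Lemma induced_vertex (s : {fset V}) v :
  simplex K s /\ s `<=` S -> v \in s -> vertex K v && (v \in S).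
Proof.
by case=> Ks /fsubsetP sS vs; rewrite (simplex_vertex Ks vs) sS.
Qed.

Lemma induced1 v :
  vertex K v && (v \in S) -> simplex K [fset v] /\ [fset v] `<=` S.
Proof. by case/andP=> Kv vS; rewrite fsub1set; split=> //; apply: simplex1. Qed.

Lemma inducedS (s t : {fset V}) :
  s `<=` t -> simplex K t /\ t `<=` S -> simplex K s /\ s `<=` S.
Proof.
by move=> st [Kt tS]; split; [apply: simplexS Kt | apply: fsubset_trans tS].
Qed.

Definition induced : simplicial_complex V :=
  SimplicialComplex induced_vertex induced1 inducedS.

End Induced.

(* Maps are total on the ambient vertex types; only their values on vertices
   of the source complex are constrained. *)
Definition simplicial_map (V W : choiceType) (K : simplicial_complex V)
    (L : simplicial_complex W) (f : V -> W) : Prop :=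
  forall s : {fset V}, simplex K s -> simplex L [fset f v | v in s].

Definition nondegenerate_map (V W : choiceType) (K : simplicial_complex V)
    (f : V -> W) : Prop :=
  forall s : {fset V}, simplex K s -> {in s &, injective f}.

Section XF2.
Variable n : nat.
Implicit Types (s t : {fset 'rV['F_2]_n}) (v : 'rV['F_2]_n).

Lemma free_fset_sub s t :
  s `<=` t -> free (t : seq _) -> free (s : seq _).
Proof.
move=> /fsubsetP st ft.
rewrite (@perm_free _ _ _ [seq v <- t | v \in s]) ?filter_free //.
apply: uniq_perm; rewrite ?filter_uniq ?fset_uniq // => v.
by rewrite mem_filter andb_idr //; apply: st.
Qed.

Lemma free_fset1 v : v != 0 -> free ([fset v] : seq _).
Proof.
move=> v0; rewrite (@perm_free _ _ _ [:: v]) ?seq1_free //.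
by apply: uniq_perm; rewrite ?fset_uniq // => w; rewrite !inE.
Qed.

Lemma free_fset_neq0 s v : free (s : seq _) -> v \in s -> v != 0.
Proof. exact: free_not0. Qed.

Definition X_F2 : simplicial_complex 'rV['F_2]_n :=
  @SimplicialComplex _ (fun v => v != 0) (fun s => free (s : seq _))
    free_fset_neq0 free_fset1 free_fset_sub.

End XF2.

Definition is_Zbasis (n : nat) (B : {fset 'rV[int]_n}) : Prop :=
  forall v : 'rV[int]_n,
    exists! c : {ffun B -> int}, v = \sum_(b : B) c b *: val b.

Definition unimodular (n : nat) (s : {fset 'rV[int]_n}) : Prop :=
  exists2 B : {fset 'rV[int]_n}, is_Zbasis B & s `<=` B.

Definition primitive (n : nat) (v : 'rV[int]_n) : bool :=
  (\big[gcdn/0]_(i < n) `|v 0%R i|)%N == 1%N.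


Lemma Zbasis_rows n (A : 'M[int]_n) :
  A \in unitmx -> is_Zbasis [fset row i A | i in 'I_n].
Proof.
move=> uA; set B := [fset _ | _ in _].
have rowB i : row i A \in B by apply/imfsetP; exists i.
have row_inj : injective (fun i => row i A).
  move=> i j /= /(congr1 (mulmx^~ (invmx A))).
  rewrite -!row_mul mulmxV // !row1 => /rowP/(_ i).
  by rewrite !mxE !eqxx; case: eqP.
pose h i : B := [` rowB i].
have h_inj : injective h by move=> i j /(congr1 val) /row_inj.
have h_surj (b : B) : {i | h i == b}.
  apply: sigW; have /imfsetP[i _ ib] := valP b.
  by exists i; apply/eqP/val_inj.
pose g b := sval (h_surj b).
have hK : cancel g h by move=> b; apply/eqP/(svalP (h_surj b)).
have gK : cancel h g by move=> i; apply: h_inj; rewrite hK.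
have sumB (c : {ffun B -> int}) :
    \sum_(b : B) c b *: val b = (\row_i c (h i)) *m A.
  rewrite mulmx_sum_row (reindex h) /=; last by exists g => x _; rewrite ?hK.
  by apply: eq_bigr => i _; rewrite mxE.
move=> v; exists [ffun b => (v *m invmx A) 0 (g b)]; split.
  rewrite sumB -[LHS](mulmxKV uA); congr (_ *m _).
  by apply/rowP=> i; rewrite [RHS]mxE ffunE gK.
move=> c; rewrite sumB => ->; apply/ffunP=> b.
by rewrite ffunE mulmxK // mxE hK.
Qed.

Section XZ.
Variable n : nat.
Implicit Types (s t : {fset 'rV[int]_n}) (v : 'rV[int]_n).

Lemma unimodular1 v : primitive v -> unimodular [fset v].
Proof.
case: n v => [|m] v; first by rewrite /primitive big_ord0.
have [L uL [R uR [d _ vE]]] := int_Smith_normal_form v.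
move=> /eqP pv.
have vi i : v 0 i = L 0 0 * d`_0 * R 0 i.
  rewrite {1}vE -mulmxA mxE big_ord1 -mulrA; congr (_ * _).
  rewrite mxE (bigD1 ord0) //= big1 ?addr0 => [|j j0]; rewrite !mxE ?eqxx //.
  by rewrite eq_sym (negPf j0 : (j == 0 :> nat) = false) mulr0n mul0r.
have uLd : L 0 0 * d`_0 \is a GRing.unit.
  have /dvdzP[q qE] : ((L 0 0 * d`_0)%R %| 1)%Z.
    rewrite dvdzE -[absz 1]pv; apply/dvdn_biggcdP=> i _.
    by rewrite vi (abszM (_ * _)) dvdn_mulr.
  by apply/unitrPr; exists q; rewrite mulrC.
pose D : 'rV[int]_m.+1 := \row_j if j == 0 then L 0 0 * d`_0 else 1.
exists [fset row i (diag_mx D *m R) | i in 'I_m.+1].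
  apply: Zbasis_rows; rewrite unitmx_mul uR andbT unitmxE det_diag.
  rewrite (bigD1 ord0) //= big1 => [|j j0]; rewrite !mxE ?mulr1 //.
  by rewrite (negPf j0).
rewrite fsub1set; apply/imfsetP; exists ord0 => //; apply/rowP=> i.
by rewrite mul_diag_mx !mxE eqxx vi.
Qed.

Lemma unimodular_primitive s v : unimodular s -> v \in s -> primitive v.
Proof.
case=> B basB /fsubsetP sB /sB vB; rewrite /primitive.
set g := (\big[gcdn/0]_(i < n) _)%N.
have [w vE] : exists w : 'rV[int]_n, v = g%:Z *: w.
  exists (\row_i ((v 0 i)%R %/ g%:Z)%Z); apply/rowP=> i; rewrite !mxE mulrC divzK //.
  by rewrite dvdzE /=; apply: (biggcdn_inf i).
have [c [wE _]] := basB w.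
have [e [_ e_uniq]] := basB v.
have e1 : e = [ffun b => g%:Z * c b].
  apply: e_uniq; rewrite {1}vE wE scaler_sumr.
  by apply: eq_bigr => b _; rewrite ffunE scalerA.
have e2 : e = [ffun b => (b == [` vB])%:R].
  apply: e_uniq; rewrite (bigD1 [` vB]) //= ffunE eqxx scale1r big1 ?addr0 //.
  by move=> b bv; rewrite ffunE (negPf bv) scale0r.
have := congr1 (fun f : {ffun B -> int} => f [` vB]) e1.
rewrite {1}e2 !ffunE eqxx => /(congr1 absz).
by rewrite abszM /= => /esym/eqP; rewrite muln_eq1 => /andP[].
Qed.

Lemma unimodularS s t : s `<=` t -> unimodular t -> unimodular s.
Proof. by move=> st [B basB tB]; exists B => //; apply: fsubset_trans tB. Qed.

Definition X_Z : simplicial_complex 'rV[int]_n :=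
  SimplicialComplex unimodular_primitive unimodular1 unimodularS.

End XZ.

Definition reduction (n : nat) (v : 'rV[int]_n) : 'rV['F_2]_n :=
  map_mx intr v.

(* The last clause is equality of simplicial maps, checked on vertices. *)
Definition lift_of_inclusion (n : nat) (S : {fset 'rV['F_2]_n})
    (f : 'rV['F_2]_n -> 'rV[int]_n) : Prop :=
  [/\ simplicial_map (induced (X_F2 n) S) (X_Z n) f,
      nondegenerate_map (induced (X_F2 n) S) f
    & forall v, vertex (induced (X_F2 n) S) v -> reduction (f v) = v].

(* Main.v *)
Require Import Defs.
From mathcomp Require Import all_boot all_order all_algebra finmap.
From mathcomp Require Import zify ring.
Import GRing.Theory.
Local Open Scope ring_scope.
Local Open Scope fset_scope.

(** A lift [f] sends every basis of F_2^4 contained in [S] to a Z-basis of Z^4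
    ([lift_unitmx]), that is, to four vectors with determinant 1 or -1.  The
    theorem says that integers cannot satisfy all these equations at once.

    At most one nonzero vector [w] is outside [S].  In a basis of F_2^4 where
    [w] is (0,0,1,1), the four basis vectors and their sum (1,1,1,1) all lie in
    [S].  Multiplying the lift by the inverse of the integral matrix formed by
    the images of the basis vectors makes the lift fix the standard basis; the
    coordinates of the image of (1,1,1,1) are then 1 or -1, because each of them
    is a determinant, and changing the signs of the coordinates makes
    the lift fix (1,1,1,1) as well ([labelled_lift], [normalised_lift]).

    These five fixed vectors turn the problem into a finite one.  Let [v] be the
    image of another vector [c].  A coordinate of [v] is, up to sign, the
    determinant of [v] and three standard basis vectors, so it is 1 or -1 where
    [c] has a 1.  A difference of two coordinates of [v] is, up to sign, the
    determinant of [v], (1,1,1,1) and two standard basis vectors, so it is 1 or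
    -1 when [c] has a 1 at one of the two places only.  Hence a coordinate at
    which [c] is 0 is 0, 2 or -2.  Up to sign, five vectors are left for
    each of the nine remaining [c] ([framed_candidate]).  A sign in front of an
    image does not affect the conditions, so one of each pair of opposite
    candidates suffices.

    There remain 5^9 assignments.  A backtracking search rejects them all after
    trying fewer than 500 partial ones: each time some basis gets a determinant
    other than 1 and -1 ([search_complete], [search_fails]).  For instance the lift
    with coordinates 0 and 1 fails on the basis (0,1,1,1), (1,0,1,1), (1,1,0,1),
    (1,1,1,0), whose integral determinant is -3. *)

(** * Lifts and integral bases *)

Lemma free_rows n (A : 'M['F_2]_n) :
  A \in unitmx -> free [tuple row i A | i < n].
Proof.
move=> uA; apply/freeP => k; rewrite (eq_bigr (fun i => (\row_i k i) 0 i *: row i A)).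
  rewrite -mulmx_sum_row => /(canRL (mulmxK uA)); rewrite mul0mx => k0 i.
  by move/rowP/(_ i): k0; rewrite !mxE.
by move=> i _; rewrite mxE (nth_map i) ?size_tuple // nth_ord_enum.
Qed.

Lemma row_inj_unitmx (R : comUnitRingType) n (A : 'M[R]_n) :
  A \in unitmx -> injective (fun i => row i A).
Proof.
move=> uA i j /= /(congr1 (mulmx^~ (invmx A))).
rewrite -!row_mul mulmxV // !row1 => /rowP/(_ i).
by rewrite !mxE !eqxx; case: eqVneq => // _ /eqP; rewrite oner_eq0.
Qed.

(** If the rows of [A] belong to a basis [B], the coefficients, on those rows,
    of the expansions of the standard vectors in [B] form a right inverse of
    [A]: each row of [A] has only one expansion in [B]. *)
Lemma unimodular_unitmx n (A : 'M[int]_n) :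
  injective (fun i => row i A) -> unimodular [fset row i A | i in 'I_n] ->
  A \in unitmx.
Proof.
move=> Ainj [B basB /fsubsetP sB].
have rB i : row i A \in B by apply: sB; apply/imfsetP; exists i.
have /fin_all_exists[c cE] (j : 'I_n) : exists c : {ffun B -> int},
    delta_mx 0 j = \sum_(b : B) c b *: val b.
  by have [c [cE _]] := basB (delta_mx 0 j); exists c.
have uniqB : forall (d d' : {ffun B -> int}),
    \sum_(b : B) d b *: val b = \sum_(b : B) d' b *: val b -> d = d'.
  by move=> d d' E; have [e [_ eU]] := basB (\sum_b d b *: val b);
     rewrite -(eU d) // -(eU d').
pose C := \matrix_(j, i) c j [` rB i].
suff inv_A : A *m C = 1%:M by case: (mulmx1_unit inv_A).
apply/matrixP => k i.
have /ffunP/(_ [` rB i]) :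
    [ffun b => \sum_j A k j * c j b] = [ffun b => (b == [` rB k])%:R].
  apply: uniqB; transitivity (row k A).
    rewrite [RHS]row_sum_delta; under eq_bigr do rewrite ffunE scaler_suml.
    rewrite exchange_big; apply: eq_bigr => j _; rewrite mxE cE scaler_sumr.
    by apply: eq_bigr => b _; rewrite scalerA.
  rewrite (bigD1 [` rB k]) //= ffunE eqxx scale1r big1 ?addr0 // => b /negPf bk.
  by rewrite ffunE bk scale0r.
rewrite !ffunE -(inj_eq val_inj) /= (inj_eq Ainj) eq_sym !mxE => <-.
by apply: eq_bigr => j _; rewrite mxE.
Qed.

(** Nondegeneracy is what makes the images of the rows distinct, so that they
    fill a square matrix. *)
Lemma lift_unitmx n (S : {fset 'rV['F_2]_n}) f (A : 'M['F_2]_n) :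
  lift_of_inclusion S f -> A \in unitmx -> (forall i, row i A \in S) ->
  \matrix_i f (row i A) \in unitmx.
Proof.
move=> [fsim fnd _] uA AS; set M := \matrix_i _.
pose s := [fset row i A | i in 'I_n].
have rs i : row i A \in s by apply/imfsetP; exists i.
have Ks : simplex (induced (X_F2 n) S) s.
  split; last by apply/fsubsetP => _ /imfsetP[i _ ->].
  rewrite /= (@perm_free _ _ _ [tuple row i A | i < n]) ?free_rows //.
  apply: uniq_perm; rewrite ?fset_uniq ?(free_uniq (free_rows _ _ uA)) // => v.
  apply/imfsetP/mapP => [[i _ ->]|[i _ ->]]; exists i => //.
  by rewrite mem_enum.
apply: unimodular_unitmx => [i j|].
  by rewrite !rowK => /(fnd s Ks _ _ (rs i) (rs j)) /row_inj_unitmx; apply.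
suff -> : [fset row i M | i in 'I_n] = [fset f v | v in s] by exact: fsim.
apply/fsetP => v; apply/imfsetP/imfsetP => [[i _ ->]|[_ /imfsetP[i _ ->] ->]] /=.
  by exists (row i A); rewrite ?rowK.
by exists i; rewrite ?rowK.
Qed.

(** * The missing vector *)

Lemma missing_vector (S : {fset 'rV['F_2]_4}) :
  (forall v, v \in S -> v != 0) -> (14 <= #|` S|)%N ->
  exists2 w : 'rV['F_2]_4, w != 0 & forall v, v != 0 -> v != w -> v \in S.
Proof.
move=> S0 cS; pose V : {set 'rV['F_2]_4} := [set v | v \in S]%SET.
have cV : #|V| = #|` S| by rewrite cardsE (card_uniqP (fset_uniq S)).
pose T : {set 'rV['F_2]_4} := (~: (0%R |: V))%SET.
have cT : (#|T| <= 1)%N.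
  have := cardsCs T; rewrite setCK.
  rewrite card_mx card_Fp // cardsU1 cV inE (_ : 0 \in S = false); last first.
    by apply/negP => /S0; rewrite eqxx.
  move=> -> /=; rewrite leq_subLR.
  by apply: leq_trans (leq_add _ (leqnn 1)); last exact: (leq_add (leqnn 1) cS).
have inT v : (v \in T) = (v != 0) && (v \notin S) by rewrite !inE negb_or.
have [T0|[w wT]] := set_0Vmem T.
  (* Here S contains all nonzero vectors: any of them can be taken for w. *)
  exists (const_mx 1); first by apply/eqP => /rowP/(_ 0); rewrite !mxE.
  move=> v v0 _; apply: contraT => vS.
  by have := in_set0 v; rewrite -T0 inT v0 vS.
exists w; first by move: wT; rewrite inT => /andP[].
move=> v v0 vw; apply: contraT => vS.
move: cT; rewrite (cardsD1 w) wT (cardsD1 v).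
by rewrite in_setD1 vw inT v0 vS.
Qed.

Lemma unitmx_maps (F : fieldType) n (u w : 'rV[F]_n) :
  u != 0 -> w != 0 -> exists2 P : 'M[F]_n, P \in unitmx & u *m P = w.
Proof.
move=> u0 w0.
have E : u *m (pinvmx u *m w) = w.
  have /row_freeP[v uv] : row_free u by rewrite /row_free rank_rV u0.
  by rewrite mulmxA -[X in X *m w]mulmx1 -uv mulmxA mulmxKpV ?submx_refl // uv mul1mx.
have [|P uP PE] := @complete_unitmx _ _ _ u (pinvmx u *m w).
  by rewrite E !rank_rV u0 w0.
by exists P => //; rewrite -PE.
Qed.

(** * Determinants of quadruples of integral vectors *)

(** Quadruples of integers and an expanded determinant, rather than row vectors
    and [\det], so that the final search can be evaluated. *)
Notation vec4 := (int * int * int * int)%type.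

Definition det3 (a b c d e f g h i : int) : int :=
  a * (e * i - f * h) - b * (d * i - f * g) + c * (d * h - e * g).

Definition det4 (u v w z : vec4) : int :=
  let: (u0, u1, u2, u3) := u in let: (v0, v1, v2, v3) := v in
  let: (w0, w1, w2, w3) := w in let: (z0, z1, z2, z3) := z in
  u0 * det3 v1 v2 v3 w1 w2 w3 z1 z2 z3 - u1 * det3 v0 v2 v3 w0 w2 w3 z0 z2 z3
  + u2 * det3 v0 v1 v3 w0 w1 w3 z0 z1 z3 - u3 * det3 v0 v1 v2 w0 w1 w2 z0 z1 z2.

Definition pm1 (x : int) : bool := `|x|%N == 1%N.
Definition oddz (x : int) : bool := odd `|x|%N.

Lemma pm1M x y : pm1 (x * y) = pm1 x && pm1 y.
Proof. by rewrite /pm1 abszM muln_eq1. Qed.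

Lemma unit_pm1 (x : int) : (x \is a GRing.unit) = pm1 x.
Proof. by change ((x == 1) || (x == -1) = pm1 x); rewrite /pm1; lia. Qed.

Lemma oddzB x y : oddz (x - y) = oddz x (+) oddz y.
Proof. by rewrite /oddz; lia. Qed.

Lemma intr_F2_eq0 (x : int) : ((x%:~R : 'F_2) == 0) = ~~ oddz x.
Proof.
rewrite [x in LHS]intEsign rmorphM rmorph_sign mulf_eq0 signr_eq0 /=.
by rewrite -(dvdn_pcharf (pchar_Fp (isT : prime 2))) dvdn2.
Qed.

Definition seqz (v : vec4) : seq int :=
  let: (v0, v1, v2, v3) := v in [:: v0; v1; v2; v3].

Definition rowz (v : vec4) : 'rV[int]_4 := \row_j (seqz v)`_j.

Definition coords (u : 'rV[int]_4) : vec4 := (u 0 0, u 0 1, u 0 2, u 0 3).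

Lemma coordsK : cancel coords rowz.
Proof.
move=> u; apply/rowP => j; rewrite mxE.
by case: j => [[|[|[|[|//]]]] ?] /=; congr (u _ _); apply/val_inj.
Qed.

Lemma rowzK : cancel rowz coords.
Proof. by case=> [[[v0 v1] v2] v3]; rewrite /coords /= !mxE. Qed.

Definition seq4 (T : Type) (c0 c1 c2 c3 : T) (i : 'I_4) : T :=
  nth c0 [:: c0; c1; c2; c3] i.

Definition minor0 (a : nat -> nat -> int) (j i k : nat) : int := a i.+1 (bump j k).

(** The entries and minors are indexed by [nat] so that the expansion applies to
    its own right-hand side, all the way down to the empty matrix. *)
Lemma det_expand (n : nat) (a : nat -> nat -> int) :
  \det (\matrix_(i < n.+1, j < n.+1) a i j) =
  \sum_(j < n.+1) a 0%N j * ((-1) ^+ j *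
    \det (\matrix_(i < n, k < n) minor0 a j i k)).
Proof.
rewrite (expand_det_row _ 0); apply: eq_bigr => j _; rewrite mxE /cofactor add0n.
by congr (_ * (_ * \det _)); apply/matrixP => i k; rewrite !mxE.
Qed.

Lemma det_rowz (c0 c1 c2 c3 : vec4) :
  \det (\matrix_i rowz (seq4 _ c0 c1 c2 c3 i)) = det4 c0 c1 c2 c3.
Proof.
pose entry i j := (seqz (nth c0 [:: c0; c1; c2; c3] i))`_j.
have -> : \matrix_i rowz (seq4 _ c0 c1 c2 c3 i) = \matrix_(i < 4, j < 4) entry i j.
  by apply/matrixP => i j; rewrite !mxE.
rewrite det_expand !big_ord_recl big_ord0 /=.
rewrite !det_expand !big_ord_recl !big_ord0 /=.
rewrite !det_expand !big_ord_recl !big_ord0 /=.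
rewrite !det_expand !big_ord_recl !big_ord0 !det_mx00 /minor0 /entry {entry} /=.
move: c0 c1 c2 c3 => [[[? ?] ?] ?] [[[? ?] ?] ?] [[[? ?] ?] ?] [[[? ?] ?] ?] /=.
by rewrite /det3; ring.
Qed.

(** * Lifts on labelled vectors *)

Definition e0 : vec4 := (1, 0, 0, 0).
Definition e1 : vec4 := (0, 1, 0, 0).
Definition e2 : vec4 := (0, 0, 1, 0).
Definition e3 : vec4 := (0, 0, 0, 1).
Definition ones : vec4 := (1, 1, 1, 1).

Definition std_basis : seq vec4 := [:: e0; e1; e2; e3].
Definition frame : seq vec4 := ones :: std_basis.

Definition others : seq vec4 :=
  [:: (0, 1, 0, 1); (0, 1, 1, 0); (1, 0, 0, 1); (1, 0, 1, 0); (1, 1, 0, 0);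
      (0, 1, 1, 1); (1, 0, 1, 1); (1, 1, 0, 1); (1, 1, 1, 0)].

(** The coordinates of the nonzero vectors of F_2^4 other than the missing one,
    written as integers 0 and 1. *)
Definition labels : seq vec4 := frame ++ others.
Definition missing_label : vec4 := (0, 0, 1, 1).

Lemma labels_neq_missing c : c \in labels ->
  reduction (rowz c) != reduction (rowz missing_label).
Proof.
suff /allP : all (fun c : vec4 => has
    (fun i => oddz ((seqz c)`_i - (seqz missing_label)`_i)) (iota 0 4)) labels.
  move=> H /H /hasP[i]; rewrite mem_iota => i4.
  apply: contraTneq => /rowP/(_ (Ordinal i4)).
  by rewrite !mxE => /eqP; rewrite -subr_eq0 -rmorphB intr_F2_eq0.
by vm_compute.
Qed.

(** What is left of a lift: four labels are a basis mod 2 when their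
    determinant is odd, and then their images must be a Z-basis. *)
Definition label_lift (F : vec4 -> vec4) : Prop :=
  {in labels & labels, forall c0 c1, {in labels & labels, forall c2 c3,
    oddz (det4 c0 c1 c2 c3) -> pm1 (det4 (F c0) (F c1) (F c2) (F c3))}}.

(** [P] changes the basis of F_2^4 so that the missing vector gets the
    coordinates [missing_label]; [M] has the images of the new basis vectors as
    rows, so [invmx M] sends these images to the standard basis of Z^4. *)
Lemma labelled_lift (S : {fset 'rV['F_2]_4}) (f : 'rV['F_2]_4 -> 'rV[int]_4) :
  (forall v, v \in S -> v != 0) -> (14 <= #|` S|)%N -> lift_of_inclusion S f ->
  exists2 F : vec4 -> vec4, {in std_basis, F =1 id} & label_lift F.
Proof.
move=> S0 cS lf; have [w w0 wS] := missing_vector _ S0 cS.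
have m0 : reduction (rowz missing_label) != 0.
  by apply/eqP => /rowP/(_ 2); rewrite !mxE /=.
have [P uP Pw] := unitmx_maps _ _ _ _ m0 w0.
pose X c := reduction (rowz c) *m P.
pose D c := f (X c).
have uD (c : 'I_4 -> vec4) : (forall i, c i \in labels) ->
    oddz (\det (\matrix_i rowz (c i))) -> \matrix_i D (c i) \in unitmx.
  move=> cl odd_c; pose A := map_mx intr (\matrix_i rowz (c i)) *m P.
  have uA : A \in unitmx.
    by rewrite unitmx_mul uP andbT unitmxE det_map_mx unitfE intr_F2_eq0 negbK.
  have rA i : row i A = X (c i) by rewrite row_mul -map_row rowK.
  have := @lift_unitmx _ _ _ A lf uA; under eq_mx do rewrite rA; apply => i.
  apply: wS; rewrite ?rA.
    have /row_freeP[B AB] : row_free A by rewrite row_free_unit.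
    rewrite -rA; apply/eqP => Ai0; have := congr1 (row i) AB.
    rewrite row_mul Ai0 mul0mx row1 => /rowP/(_ i); rewrite !mxE !eqxx.
    by move/eqP; rewrite eq_sym oner_eq0.
  rewrite -Pw; apply: contra_neq (labels_neq_missing _ (cl i)).
  exact: (can_inj (mulmxK uP)).
pose E := seq4 _ e0 e1 e2 e3.
pose M := \matrix_i D (E i).
have uM : M \in unitmx.
  by apply: uD => [[[|[|[|[|//]]]] ?]|]; last rewrite det_rowz.
exists (fun c => coords (D c *m invmx M)) => [c|].
  move=> cE; have [i ->] : exists i, c = E i.
    have /(nthP e0)[i i4 <-] := cE; by exists (Ordinal i4).
  rewrite -[D _](rowK (fun i => D (E i)) i) -row_mul mulmxV //.
  rewrite -[RHS]rowzK; congr coords; apply/rowP => j; rewrite !mxE.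
  by case: i {cE} j => [[|[|[|[|//]]]] ?] [[|[|[|[|//]]]] ?].
move=> c0 c1 l0 l1 c2 c3 l2 l3; rewrite -!det_rowz -!unit_pm1 => odd_c.
pose c := seq4 _ c0 c1 c2 c3; pose G d := coords (D d *m invmx M).
have -> : \matrix_i rowz (seq4 _ (G c0) (G c1) (G c2) (G c3) i)
          = (\matrix_i D (c i)) *m invmx M.
  apply/row_matrixP => i; rewrite row_mul !rowK.
  by case: i => [[|[|[|[|//]]]] ?]; rewrite /seq4 /= coordsK.
rewrite -unitmxE unitmx_mul unitmx_inv uM andbT; apply: uD => //.
by case=> [[|[|[|[|//]]]] ?].
Qed.

(** * Candidates for the images *)

Definition differ (b b' x x' : int) : bool := oddz (b - b') ==> pm1 (x - x').

Definition admissible (c v : vec4) : bool :=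
  let: (c0, c1, c2, c3) := c in let: (x0, x1, x2, x3) := v in
  [&& differ c0 c1 x0 x1, differ c0 c2 x0 x2, differ c0 c3 x0 x3,
      differ c1 c2 x1 x2, differ c1 c3 x1 x3 & differ c2 c3 x2 x3].

(** Selects one of two opposite vectors, when a coordinate is odd
    ([positiveN]). *)
Definition positive (v : vec4) : bool :=
  let: (x0, x1, x2, x3) := v in
  if oddz x0 then 0 < x0 else if oddz x1 then 0 < x1 else
  if oddz x2 then 0 < x2 else 0 < x3.

Definition entries (b : int) : seq int :=
  if oddz b then [:: 1; -1] else [:: 0; 2; -2].

Definition candidates (c : vec4) : seq vec4 :=
  let: (c0, c1, c2, c3) := c in
  [seq v <- [seq (p, x3) | p <- [seq (p, x2) | p <- [seq (x0, x1)
      | x0 <- entries c0, x1 <- entries c1], x2 <- entries c2], x3 <- entries c3]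
   | positive v && admissible c v].

Lemma det4_coord (v : vec4) :
  (det4 v e1 e2 e3 = v.1.1.1) * (det4 v e0 e3 e2 = v.1.1.2) *
  (det4 v e0 e1 e3 = v.1.2) * (det4 v e0 e2 e1 = v.2).
Proof. by case: v => [[[v0 v1] v2] v3]; rewrite /det4 /det3 /=; do !split; ring. Qed.

Lemma det4_diff (v : vec4) :
  (det4 v ones e2 e3 = v.1.1.1 - v.1.1.2) * (det4 v ones e3 e1 = v.1.1.1 - v.1.2) *
  (det4 v ones e1 e2 = v.1.1.1 - v.2) * (det4 v ones e0 e3 = v.1.1.2 - v.1.2) *
  (det4 v ones e2 e0 = v.1.1.2 - v.2) * (det4 v ones e0 e1 = v.1.2 - v.2).
Proof. by case: v => [[[v0 v1] v2] v3]; rewrite /det4 /det3 /=; do !split; ring. Qed.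

(** The conditions on an image [v] of [c] that involve only [v] and vectors
    fixed by the lift. *)
Definition framed (c v : vec4) : Prop :=
  {in frame & &, forall u0 u1 u2,
    oddz (det4 c u0 u1 u2) -> pm1 (det4 v u0 u1 u2)}.

Lemma framed_coord (c v : vec4) : framed c v ->
  [/\ oddz c.1.1.1 -> pm1 v.1.1.1, oddz c.1.1.2 -> pm1 v.1.1.2,
      oddz c.1.2 -> pm1 v.1.2 & oddz c.2 -> pm1 v.2].
Proof.
move=> cv.
have := cv e0 e2 e1 isT isT isT; have := cv e0 e1 e3 isT isT isT.
have := cv e0 e3 e2 isT isT isT; have := cv e1 e2 e3 isT isT isT.
by rewrite !det4_coord.
Qed.

Definition odd_vec (v : vec4) : bool :=
  [|| oddz v.1.1.1, oddz v.1.1.2, oddz v.1.2 | oddz v.2].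

Lemma framed_odd (c v : vec4) : framed c v -> odd_vec c -> odd_vec v.
Proof.
have odd1 x : pm1 x -> oddz x by rewrite /pm1 /oddz => /eqP->.
by move=> /framed_coord[t0 t1 t2 t3] /or4P[/t0|/t1|/t2|/t3] /odd1 v_odd;
  apply/or4P; [apply: Or41 | apply: Or42 | apply: Or43 | apply: Or44].
Qed.

(** Where [c] is even, comparing with a place where [c] is odd bounds the
    coordinate: it differs by 1 from 1 or -1. *)
Lemma framed_candidate (c v : vec4) :
  framed c v -> odd_vec c -> positive v -> v \in candidates c.
Proof.
move=> cv c_odd v_pos; have [] := framed_coord _ _ cv.
case: c v cv c_odd v_pos => [[[c0 c1] c2] c3] [[[v0 v1] v2] v3] test c_odd v_pos.
rewrite /= => t0 t1 t2 t3.
have adm : admissible (c0, c1, c2, c3) (v0, v1, v2, v3).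
  rewrite /admissible; do ?[apply/andP; split]; apply/implyP.
  - by have := test ones e2 e3 isT isT isT; rewrite !det4_diff.
  - by have := test ones e3 e1 isT isT isT; rewrite !det4_diff.
  - by have := test ones e1 e2 isT isT isT; rewrite !det4_diff.
  - by have := test ones e0 e3 isT isT isT; rewrite !det4_diff.
  - by have := test ones e2 e0 isT isT isT; rewrite !det4_diff.
  - by have := test ones e0 e1 isT isT isT; rewrite !det4_diff.
rewrite mem_filter; apply/andP; split; first exact/andP.
rewrite !(allpairs_f (fun p x => (p, x))) //; move: c_odd adm t0 t1 t2 t3;
  rewrite /odd_vec /admissible /differ !oddzB /entries /=;
  case: (oddz c0); case: (oddz c1); case: (oddz c2); case: (oddz c3) => //= _;
  rewrite !inE /pm1 ?andbT ?implybT; clear; lia.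
Qed.

(** * Normalisation of signs *)

Definition opp4 (v : vec4) : vec4 :=
  let: (v0, v1, v2, v3) := v in (- v0, - v1, - v2, - v3).

Lemma positiveN (v : vec4) : odd_vec v -> positive (opp4 v) = ~~ positive v.
Proof.
case: v => [[[v0 v1] v2] v3]; rewrite /odd_vec /positive /opp4 /oddz !abszN /=.
by do ![case: ifP => ?]; lia.
Qed.

(** Multiplication by [a] and by the diagonal matrix of [s]. *)
Definition twist (a : int) (s v : vec4) : vec4 :=
  let: (s0, s1, s2, s3) := s in let: (v0, v1, v2, v3) := v in
  (a * s0 * v0, a * s1 * v1, a * s2 * v2, a * s3 * v3).

Lemma det4_twist a0 a1 a2 a3 (s v0 v1 v2 v3 : vec4) :
  det4 (twist a0 s v0) (twist a1 s v1) (twist a2 s v2) (twist a3 s v3) =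
  a0 * a1 * a2 * a3 * (s.1.1.1 * s.1.1.2 * s.1.2 * s.2) * det4 v0 v1 v2 v3.
Proof.
move: s v0 v1 v2 v3 => [[[? ?] ?] ?] [[[? ?] ?] ?] [[[? ?] ?] ?] [[[? ?] ?] ?]
  [[[? ?] ?] ?].
by rewrite /det4 /det3 /=; ring.
Qed.

Lemma opp4_twist a s v : opp4 (twist a s v) = twist (- a) s v.
Proof.
by case: s v => [[[s0 s1] s2] s3] [[[v0 v1] v2] v3]; rewrite /= !mulNr.
Qed.

Definition unit_vec (s : vec4) : bool :=
  [&& pm1 s.1.1.1, pm1 s.1.1.2, pm1 s.1.2 & pm1 s.2].

(** The diagonal matrix of [s] sends [s] to [ones] when the coordinates of [s]
    are 1 or -1; the sign in front restores the standard basis vectors and makes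
    the other images positive. *)
Definition normalise (s v : vec4) : vec4 :=
  twist (if positive (twist 1 s v) then 1 else -1) s v.

Lemma normalise_positive s v : odd_vec (normalise s v) -> positive (normalise s v).
Proof.
rewrite /normalise; case: ifP => // /negP neg_v odd_v; apply: contraT.
by rewrite -positiveN // opp4_twist opprK.
Qed.

Lemma pm1_normalise s v0 v1 v2 v3 : unit_vec s ->
  pm1 (det4 (normalise s v0) (normalise s v1) (normalise s v2) (normalise s v3))
  = pm1 (det4 v0 v1 v2 v3).
Proof.
move=> /and4P[s0 s1 s2 s3]; rewrite /normalise det4_twist !pm1M s0 s1 s2 s3.
by do 4!case: ifP => _.
Qed.

Lemma normalise_frame s : unit_vec s ->
  {in std_basis, normalise s =1 id} /\ normalise s s = ones.
Proof.
have pm1P x : pm1 x -> x = 1 \/ x = -1 by rewrite /pm1; lia.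
case: s => [[[s0 s1] s2] s3] /and4P[/= /pm1P u0 /pm1P u1 /pm1P u2 /pm1P u3].
split=> [v|]; last by case: u0 u1 u2 u3 => -> [] -> [] -> [] ->.
by rewrite !inE => /or4P[] /eqP->; case: u0 u1 u2 u3 => -> [] -> [] -> [] ->.
Qed.

Lemma normalised_lift (F : vec4 -> vec4) :
  {in std_basis, F =1 id} -> label_lift F ->
  exists H : vec4 -> vec4, [/\ label_lift H, {in frame, H =1 id}
    & {in others, forall c, H c \in candidates c}].
Proof.
move=> Fe Fl; set s := F ones.
have s_unit : unit_vec s.
  have test u0 u1 u2 : u0 \in std_basis -> u1 \in std_basis -> u2 \in std_basis ->
      oddz (det4 ones u0 u1 u2) -> pm1 (det4 s u0 u1 u2).
    move=> b0 b1 b2; rewrite -{2}(Fe u0) // -{2}(Fe u1) // -{2}(Fe u2) //.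
    by apply: Fl; rewrite // mem_cat inE ?b0 ?b1 ?b2 ?orbT.
  apply/and4P; split.
  - by have := test e1 e2 e3 isT isT isT isT; rewrite det4_coord.
  - by have := test e0 e3 e2 isT isT isT isT; rewrite det4_coord.
  - by have := test e0 e1 e3 isT isT isT isT; rewrite det4_coord.
  - by have := test e0 e2 e1 isT isT isT isT; rewrite det4_coord.
have [He Hs] := normalise_frame _ s_unit; pose H c := normalise s (F c).
have Hl : label_lift H.
  by move=> c0 c1 l0 l1 c2 c3 l2 l3 odd_c; rewrite pm1_normalise // Fl.
have Hfr : {in frame, H =1 id}.
  by move=> c; rewrite /frame in_cons /H => /orP[/eqP->|cb];
     rewrite -/s ?Hs ?Fe ?He.
exists H; split=> // c c_others.
have cH : framed c (H c).
  have fl u : u \in frame -> u \in labels by rewrite mem_cat => ->.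
  have lc : c \in labels by rewrite mem_cat c_others orbT.
  move=> u0 u1 u2 fu0 fu1 fu2 /(Hl _ _ lc (fl _ fu0) _ _ (fl _ fu1) (fl _ fu2)).
  by rewrite (Hfr u0) // (Hfr u1) // (Hfr u2).
have c_odd : odd_vec c by move: c c_others {cH}; apply/allP.
by apply: framed_candidate => //; apply/normalise_positive/(framed_odd _ _ cH).
Qed.

(** * The exhaustive search *)

Fixpoint all_triples (T : Type) (p : T -> T -> T -> bool) (s : seq T) : bool :=
  if s is x :: s' then pairwise (p x) s' && all_triples T p s' else true.

Lemma all_triples_in (T : eqType) (p : T -> T -> T -> bool) (s : seq T) :
  {in s & &, forall x y z, p x y z} -> all_triples T p s.
Proof.
elim: s => //= x s IHs ps; rewrite IHs ?andbT; last first.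
  by move=> y z t ys zs ts; apply: ps; rewrite inE ?ys ?zs ?ts orbT.
have {IHs ps} : {in s &, forall y z, p x y z}.
  by move=> y z ys zs; apply: ps; rewrite inE ?ys ?zs ?eqxx ?orbT.
elim: s => //= y s IHs ps; apply/andP; split.
  by apply/allP => z zs; apply: ps; rewrite inE ?eqxx ?zs ?orbT.
by apply: IHs => z t zs ts; apply: ps; rewrite inE ?zs ?ts orbT.
Qed.

Definition compatible (p q r t : vec4 * vec4) : bool :=
  oddz (det4 p.1 q.1 r.1 t.1) ==> pm1 (det4 p.2 q.2 r.2 t.2).

Fixpoint search (env : seq (vec4 * vec4)) (todo : seq vec4) : bool :=
  if todo is c :: todo' then
    has (fun v => all_triples _ (compatible (c, v)) env
                  && search ((c, v) :: env) todo') (candidates c)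
  else true.

(** The search cannot miss a normalised lift: the branch that follows [H] passes
    every test. *)
Lemma search_complete (H : vec4 -> vec4) (env todo : seq vec4) :
  label_lift H -> {subset env ++ todo <= labels} ->
  {in todo, forall c, H c \in candidates c} ->
  search [seq (c, H c) | c <- env] todo.
Proof.
move=> Hl; elim: todo env => //= c todo IHt env sub Hc.
apply/hasP; exists (H c); first by apply: Hc; rewrite mem_head.
apply/andP; split.
  apply: all_triples_in => _ _ _ /mapP[c1 c1e ->] /mapP[c2 c2e ->] /mapP[c3 c3e ->].
  have sub_env d : d \in env -> d \in labels.
    by move=> de; apply: sub; rewrite mem_cat de.
  apply/implyP; apply: Hl; try exact: sub_env.
  by apply: sub; rewrite mem_cat mem_head orbT.
apply: (IHt (c :: env)) => [d|d dt]; last by apply: Hc; rewrite inE dt orbT.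
by move=> d_in; apply: sub; move: d_in; rewrite !mem_cat !inE orbCA orbA.
Qed.

Lemma search_fails : ~~ search [seq (c, c) | c <- frame] others.
Proof.
(* The lazy strategy matters: a strict one would evaluate both arguments of
   each conjunction and visit the 5^9 assignments without pruning. *)
by lazy.
Qed.

Theorem proposition5p2 (S : {fset 'rV['F_2]_4})
  (S_vertices : forall v, v \in S -> v != 0)
  (S_card : (14 <= #|` S|)%N) :
  ~ exists f : 'rV['F_2]_4 -> 'rV[int]_4, lift_of_inclusion S f.
Proof.
case=> f lf; have [F Fe Fl] := labelled_lift _ _ S_vertices S_card lf.
have [H [Hl Hfr Hc]] := normalised_lift _ Fe Fl.
apply: (negP search_fails).
rewrite (_ : [seq _ | _ <- _] = [seq (c, H c) | c <- frame]).
  exact: search_complete.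
by apply/eq_in_map => c /Hfr->.
Qed.
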